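(* Let $\omega<-\lambda_0(\Omega)$. If $\phi_{\Omega,\omega}\in\mathcal{A}_{\Omega,\omega}$ is an action ground state, then $\phi_{\Omega,\omega}$ is also an energy ground state with mass $m=\|\phi_{\Omega,\omega}\|_{L^2}^2$, and every energy ground state with precisely this mass $m$ is also an action ground state associated with $\omega$. Moreover, $$\mathcal{A}_{\Omega,\omega}=\bigcup_{m\in\mathcal{N}_{\Omega,\omega}}\mathcal{B}_{\Omega,m},\qquad\text{where } \mathcal{N}_{\Omega,\omega}:=\{\|\phi\|_{L^2}^2:\phi\in\mathcal{A}_{\Omega,\omega}\}.$$
   Context: Let $d\ge 2$, let $1<p<\infty$ if $d=2$ and $1<p<\frac{d+2}{d-2}$ if $d\ge 3$. Let $V:\mathbb{R}^d\to\mathbb{R}$ satisfy $V\ge 0$ and $\lim_{|\mathbf{x}|\to\infty}V(\mathbf{x})=\infty$. Let $\Omega_{\max}:=\sup\{\gamma\ge 0:\lim_{|\mathbf{x}|\to\infty}(V(\mathbf{x})-\frac{\gamma^2}{2}(x_1^2+x_2^2))=\infty\}$, assume $\Omega_{\max}>0$, and fix $0<\Omega<\Omega_{\max}$. Let $L_z=i(x_2\partial_{x_1}-x_1\partial_{x_2})$. Let $X$ be the space of complex-valued $\phi\in H^1(\mathbb{R}^d)$ with $\int_{\mathbb{R}^d}V|\phi|^2\,d\mathbf{x}<\infty$, with norm $\|\phi\|_X^2=\int_{\mathbb{R}^d}\big(|\nabla\phi|^2+(1+V)|\phi|^2\big)d\mathbf{x}$. For $\phi\in X$ the quantity $\int_{\mathbb{R}^d}\overline{\phi}L_z\phi\,d\mathbf{x}$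 is well defined and real. Define the energy $E(\phi)=\frac12\|\nabla\phi\|_{L^2}^2+\int_{\mathbb{R}^d}V|\phi|^2\,d\mathbf{x}+\frac{2}{p+1}\|\phi\|_{L^{p+1}}^{p+1}-\Omega\int_{\mathbb{R}^d}\overline{\phi}L_z\phi\,d\mathbf{x}$ and the action $S_{\Omega,\omega}(\phi)=E(\phi)+\omega\|\phi\|_{L^2}^2$. Let $\lambda_0(\Omega)=\inf_{0\ne\phi\in X}\frac{\int_{\mathbb{R}^d}(\frac12|\nabla\phi|^2+V|\phi|^2-\Omega\overline{\phi}L_z\phi)d\mathbf{x}}{\|\phi\|_{L^2}^2}$. For $\omega<-\lambda_0(\Omega)$, an action ground state associated with $\omega$ (and $\Omega$) is an element of $\mathcal{A}_{\Omega,\omega}:=\arg\min_{\phi\in X}S_{\Omega,\omega}(\phi)$ (it is known that this set is nonempty, that $\min_X S_{\Omega,\omega}<0$, and that it coincides with the set of minimizers of $S_{\Omega,\omega}$ over all nontrivial solutions of $-\frac12\Delta\phi+V\phi+|\phi|^{p-1}\phi-\Omega L_z\phi+\omega\phi=0$). For $m>0$, an energy ground state with mass $m$ is an element of $\mathcal{B}_{\Omega,m}:=\arg\min\{E(\phi):\phi\in X,\ \|\phi\|_{L^2}^2=m\}$. *)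

(* Defs.v *)
From HB Require Import structures.
From mathcomp Require Import all_boot all_order all_algebra.
From mathcomp Require Import complex.
From mathcomp Require Import all_classical all_reals all_analysis.

Set Implicit Arguments.
Unset Strict Implicit.
Unset Printing Implicit Defensive.

Import Order.TTheory GRing.Theory Num.Theory.
Import numFieldNormedType.Exports.

Local Open Scope classical_set_scope.
Local Open Scope ring_scope.

(* The Borel sigma-algebra of R^n, generated by the coordinate maps. *)
Definition rV_display : measure_display -> measure_display.
Proof. exact. Qed.

Section measurable_rV.
Context {d} {T : measurableType d} (n : nat).

Let coords (i : 'I_n) (x : 'rV[T]_n) : T := x ord0 i.

Let rV_measurable0 : g_sigma_preimage coords set0.
Proof. exact: sigma_algebra0. Qed.

Let rV_measurableC A :
  g_sigma_preimage coords A -> g_sigma_preimage coords (~` A).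
Proof. exact: sigma_algebraC. Qed.

Let rV_measurable_bigcup (F : (set 'rV[T]_n)^nat) :
  (forall i, g_sigma_preimage coords (F i)) ->
  g_sigma_preimage coords (\bigcup_i (F i)).
Proof. exact: sigma_algebra_bigcup. Qed.

HB.instance Definition _ := @isMeasurable.Build (rV_display d)
  'rV[T]_n (g_sigma_preimage coords)
  rV_measurable0 rV_measurableC rV_measurable_bigcup.

End measurable_rV.

Lemma measurable_rV_coord d (T : measurableType d) n (i : 'I_n) :
  measurable_fun [set: 'rV[T]_n] (fun x : 'rV[T]_n => x ord0 i).
Proof.
move=> _ Y mY; rewrite setTI; apply: sub_sigma_algebra => /=.
rewrite -bigcup_seq/=; exists i => /=; first by rewrite mem_index_enum.
by exists Y => //; rewrite setTI.
Qed.

Lemma measurable_fun_rVP d1 d2 (T1 : measurableType d1)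
    (T2 : measurableType d2) n (f : T1 -> 'rV[T2]_n) :
  (forall i, measurable_fun [set: T1] (fun x => f x ord0 i)) ->
  measurable_fun [set: T1] f.
Proof.
move=> mf.
suff prefS : g_sigma_preimage
    (fun i => (fun x : 'rV[T2]_n => x ord0 i) \o f) `<=` measurable.
  rewrite g_sigma_preimage_comp in prefS.
  by move=> _ A mA; apply: prefS; exists A.
apply: smallest_sub; first exact: sigma_algebra_measurable.
case: n => [|n] in f mf *; first by rewrite big_ord0.
rewrite -bigcup_mkord_ord; apply: bigcup_sub => i Ii.
by move=> A [B mB <-]; exact: mf.
Qed.

Section lebesgue_rV.
Context {R : realType}.

Definition rV_cons n (xv : R * 'rV[R]_n) : 'rV[R]_n.+1 :=
  \row_i (if unlift ord0 i is Some j then xv.2 ord0 j else xv.1).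

Definition rV_behead n (x : 'rV[R]_n.+1) : 'rV[R]_n :=
  \row_j x ord0 (lift ord0 j).

Lemma rV_consK n (xv : R * 'rV[R]_n) :
  ((rV_cons xv) ord0 ord0, rV_behead (rV_cons xv)) = xv.
Proof.
case: xv => x v; congr pair; first by rewrite mxE unlift_none.
by apply/rowP => j; rewrite !mxE liftK.
Qed.

Lemma measurable_rV_cons n : measurable_fun setT (@rV_cons n).
Proof.
apply: measurable_fun_rVP => i; case: (unliftP ord0 i) => [j ->|->].
  rewrite (_ : (fun _ => _) = (fun v : 'rV[R]_n => v ord0 j) \o snd).
    by apply: measurableT_comp; [exact: measurable_rV_coord|].
  by apply/funext => xv; rewrite mxE liftK.
rewrite (_ : (fun _ => _) = fst)//.
by apply/funext => xv; rewrite mxE unlift_none.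
Qed.

Lemma measurable_rV_behead n : measurable_fun setT (@rV_behead n).
Proof.
apply: measurable_fun_rVP => j.
rewrite (_ : (fun _ => _) =
  (fun x : 'rV[R]_n.+1 => x ord0 (lift ord0 j))).
  exact: measurable_rV_coord.
by apply/funext => x; rewrite mxE.
Qed.

Section step.
Variables (n : nat) (mu : {sigma_finite_measure set 'rV[R]_n -> \bar R}).

Definition lebesgue_step : set 'rV[R]_n.+1 -> \bar R :=
  pushforward (@lebesgue_measure R \x mu)%E (@rV_cons n).

Let lebesgue_step0 : lebesgue_step set0 = 0%E.
Proof. by rewrite /lebesgue_step /pushforward preimage_set0 measure0. Qed.

Let lebesgue_step_ge0 A : (0 <= lebesgue_step A)%E.
Proof. by rewrite /lebesgue_step /pushforward; apply: measure_ge0. Qed.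

Let lebesgue_step_sigma_additive : semi_sigma_additive lebesgue_step.
Proof.
have mc A : measurable A -> measurable (@rV_cons n @^-1` A).
  by move=> mA; rewrite -[X in measurable X]setTI; exact: measurable_rV_cons.
move=> F mF tF mUF; rewrite /lebesgue_step /pushforward preimage_bigcup.
apply: measure_semi_sigma_additive.
- by move=> k; exact: mc.
- apply/trivIsetP => /= i j _ _ ij; rewrite -preimage_setI.
  by move/trivIsetP : tF => /(_ _ _ _ _ ij) ->//; rewrite preimage_set0.
- by rewrite -preimage_bigcup; exact: mc.
Qed.

HB.instance Definition _ := isMeasure.Build _ _ _ lebesgue_step
  lebesgue_step0 lebesgue_step_ge0 lebesgue_step_sigma_additive.

Let lebesgue_step_sigma_finite : sigma_finite setT lebesgue_step.
Proof.
have /sigma_finiteP[F [FT ndF F_oo]] := sigma_finiteT (@lebesgue_measure R).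
have /sigma_finiteP[G [GT ndG G_oo]] := sigma_finiteT mu.
exists (fun k => [set x : 'rV[R]_n.+1 | F k (x ord0 ord0) /\
                                         G k (rV_behead x)]).
  apply/seteqP; split => // x _.
  have : setT (x ord0 ord0) by []. rewrite FT => -[i _ Fi].
  have : setT (rV_behead x) by []. rewrite GT => -[j _ Gj].
  exists (maxn i j) => //=; split.
    by have /subsetPset := ndF _ _ (leq_maxl i j); exact.
  by have /subsetPset := ndG _ _ (leq_maxr i j); exact.
move=> k; have [mF Foo] := F_oo k; have [mG Goo] := G_oo k; split.
  apply: measurableI.
    rewrite -[X in measurable X]setTI.
    exact: (@measurable_rV_coord _ _ n.+1 ord0 measurableT _ mF).
  rewrite -[X in measurable X]setTI.
  exact: (@measurable_rV_behead n measurableT _ mG).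
rewrite /lebesgue_step /pushforward.
rewrite (_ : _ @^-1` _ = F k `*` G k); last first.
  apply/seteqP; split => -[x v] /= [];
    by have [-> ->] := rV_consK (x, v); split.
by rewrite product_measure1E// lte_mul_pinfty// ge0_fin_numE.
Qed.

HB.instance Definition _ := @Measure_isSigmaFinite.Build _ _ _
  lebesgue_step lebesgue_step_sigma_finite.

End step.

(* Lebesgue measure on R^n: the n-fold product of the one on R. *)
Fixpoint lebesgue_rV n : {sigma_finite_measure set 'rV[R]_n -> \bar R} :=
  if n is k.+1 then [the {sigma_finite_measure set 'rV[R]_k.+1 -> \bar R} of
                     lebesgue_step (lebesgue_rV k)]
  else [the {sigma_finite_measure set 'rV[R]_0 -> \bar R} of \d_(0 : 'rV[R]_0)].

End lebesgue_rV.

Local Notation Re := (@complex.Re _).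
Local Notation Im := (@complex.Im _).

Section sobolev.
Context {R : realType} (d : nat).
Local Notation Rd := 'rV[R]_d.
Local Notation mu := (@lebesgue_rV R d).

(* |x| -> oo; the norm of 'rV is the max norm, equivalent to the Euclidean
   one. *)
Definition at_infinity : set_system Rd :=
  [set A | exists r : R, forall x : Rd, r < `|x| -> A x].

Definition partial (j : 'I_d) (f : Rd -> R) : Rd -> R :=
  fun x => 'D_(delta_mx ord0 j) f x.

Fixpoint class_C (k : nat) (f : Rd -> R) : Prop :=
  if k is k'.+1 then
    continuous f /\ forall j, (forall x, derivable f x (delta_mx ord0 j)) /\
                              class_C k' (partial j f)
  else continuous f.

Definition test_function (eta : Rd -> R) : Prop :=
  (forall k, class_C k eta) /\ compact (closure [set x | eta x != 0]).

Definition Cintegral (f : Rd -> R[i]) : R[i] :=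
  Complex (\int[mu]_x Re (f x)) (\int[mu]_x Im (f x)).

Definition cabs (z : R[i]) : R := ComplexField.Normc.normc z.

Definition CLnorm (q : R) (f : Rd -> R[i]) : R :=
  fine ('N[mu]_(q%:E) [EFin \o cabs \o f]).

Definition L2 (f : Rd -> R[i]) : Prop :=
  (Re \o f) \in Lfun mu 2%:E /\ (Im \o f) \in Lfun mu 2%:E.

Definition is_weak_partial (j : 'I_d) (f g : Rd -> R[i]) : Prop :=
  forall eta, test_function eta ->
    Cintegral (fun x => f x * (partial j eta x)%:C%C) =
    - Cintegral (fun x => g x * (eta x)%:C%C).

Definition H1 (f : Rd -> R[i]) : Prop :=
  L2 f /\ forall j, exists g, L2 g /\ is_weak_partial j f g.

(* A representative of the weak derivative, which is unique up to a null set
   for f in H^1. *)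
Definition weak_partial (j : 'I_d) (f : Rd -> R[i]) : Rd -> R[i] :=
  xget (fun=> 0) [set g | L2 g /\ is_weak_partial j f g].

Definition grad_sq (f : Rd -> R[i]) (x : Rd) : R :=
  \sum_(j < d) cabs (weak_partial j f x) ^+ 2.

End sobolev.
Arguments at_infinity {R d}.

(* The ambient dimension is d = n.+2; x_1 and x_2 are the coordinates of
   index 0 and 1. *)
Section ground_states.
Context {R : realType} (n : nat).
Local Notation Rd := 'rV[R]_n.+2.
Local Notation mu := (@lebesgue_rV R n.+2).
Local Notation i1 := (ord0 : 'I_n.+2).
Local Notation i2 := (lift ord0 ord0 : 'I_n.+2).
Implicit Types (V : Rd -> R) (p Omega omega m : R) (phi : Rd -> R[i]).

Definition Omega_max V : \bar R :=
  ereal_sup [set gamma%:E | gamma in [set gamma : R | 0 <= gamma /\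
    V x - gamma ^+ 2 / 2 * (x ord0 i1 ^+ 2 + x ord0 i2 ^+ 2)
      @[x --> at_infinity] --> +oo]].

Definition Lz phi : Rd -> R[i] := fun x =>
  'i%C * ((x ord0 i2)%:C%C * weak_partial i1 phi x -
          (x ord0 i1)%:C%C * weak_partial i2 phi x).

(* Elements are representatives of the classes of functions modulo equality
   almost everywhere. *)
Definition energy_space V : set (Rd -> R[i]) :=
  [set phi | H1 phi /\
     mu.-integrable setT (fun x => (V x * cabs (phi x) ^+ 2)%:E)].

Definition mass phi : R := CLnorm 2 phi ^+ 2.

(* The integral of phi^* L_z phi is real, hence the real part. *)
Definition energy V p Omega phi : R :=
  2^-1 * \int[mu]_x grad_sq phi x
  + \int[mu]_x (V x * cabs (phi x) ^+ 2)
  + 2 / (p + 1) * CLnorm (p + 1) phi `^ (p + 1)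
  - Omega * Re (Cintegral (fun x => (phi x)^*%C * Lz phi x)).

Definition action V p Omega omega phi : R :=
  energy V p Omega phi + omega * mass phi.

Definition rayleigh V Omega phi : R :=
  (\int[mu]_x (2^-1 * grad_sq phi x + V x * cabs (phi x) ^+ 2
               - Omega * Re ((phi x)^*%C * Lz phi x))) / mass phi.

Definition lambda0 V Omega : \bar R :=
  ereal_inf [set (rayleigh V Omega phi)%:E | phi in
    [set phi | energy_space V phi /\ ~ {ae mu, forall x, phi x = 0}]].

Definition action_ground_states V p Omega omega : set (Rd -> R[i]) :=
  [set phi | energy_space V phi /\
     forall psi, energy_space V psi ->
       action V p Omega omega phi <= action V p Omega omega psi].

(* Empty unless m > 0: energy ground states are only considered with positive
   mass. *)
Definition energy_ground_states V p Omega m : set (Rd -> R[i]) :=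
  [set phi | [/\ 0 < m, energy_space V phi, mass phi = m &
     forall psi, energy_space V psi -> mass psi = m ->
       energy V p Omega phi <= energy V p Omega psi]].

End ground_states.

(* Main.v *)
Require Import Defs.
From HB Require Import structures.
From mathcomp Require Import all_boot all_order all_algebra.
From mathcomp Require Import complex.
From mathcomp Require Import all_classical all_reals all_analysis.
From mathcomp Require Import measurable_realfun.
From mathcomp Require Import ring lra.

Set Implicit Arguments.
Unset Strict Implicit.
Unset Printing Implicit Defensive.

Import Order.TTheory GRing.Theory Num.Theory.
Import numFieldNormedType.Exports.

Local Open Scope classical_set_scope.
Local Open Scope ring_scope.

(** The action is the energy plus omega times the mass, so among functions of one
and the same mass the two functionals have the same minimizers: a minimizer of
the action minimizes the energy at its own mass m, and conversely an energy
minimizer of mass m has the same action as the action minimizer it came from.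
This gives both inclusions at once, as soon as m > 0, which energy ground
states are required to satisfy.

Positivity of the mass is the analytic content.  A function of mass zero
vanishes almost everywhere, so its action is nonnegative
([action_ge0_mass0]); it therefore suffices to find a function of negative
action ([exists_negative_action]).  As omega < - lambda0, some phi has a
negative quadratic part q = Q(phi) + omega M(phi), and
S(c phi) = c^2 q + c^(p+1) B with B >= 0 is negative for small c > 0
because p > 1.

The homogeneity of S is where work is needed, since the gradient is a chosen
representative of the weak gradient: that of c phi agrees with c times that of
phi only by uniqueness of weak derivatives ([weak_partial_unique]).
Uniqueness is the fundamental lemma of the calculus of variations
([ae_eq_test_function]).  It is obtained by building, from t |-> exp(-1/t), a
smooth function b with values in [0, 1] which is positive exactly on a given
open box; the test functions 1 - (1 - b)^k then converge boundedly to the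
indicator of the box, so a square integrable function orthogonal to all test
functions has integral zero over every box, hence over every measurable subset
of a large box by the pi-lambda theorem.

Splitting the integral that defines the Rayleigh quotient requires the angular
momentum density to be integrable.  As Omega_max > 0, the functions x_1^2 and
x_2^2 are bounded by A V + B ([Omega_max_coord_sqr_dominated]), so x_j phi is
square integrable for phi in the energy space. *)

Local Notation Re := (@complex.Re _).
Local Notation Im := (@complex.Im _).

(** * Smooth flat functions *)

Section flat.
Context {R : realType}.
Implicit Types (m : nat) (t : R).

(** The family t |-> t^-m exp(-1/t), extended by 0 to t <= 0.  It is closed under
differentiation up to linear combinations, which gives smoothness of all its
members by a single induction. *)
Definition flat m t : R := if t <= 0 then 0 else t^-1 ^+ m * expR (- t^-1).

Lemma flat_eq0 m t : t <= 0 -> flat m t = 0.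
Proof. by rewrite /flat => ->. Qed.

Lemma flatE m t : 0 < t -> flat m t = t^-1 ^+ m * expR (- t^-1).
Proof. by rewrite /flat ltNge => /negbTE->. Qed.

Lemma flat_gt0 m t : 0 < t -> 0 < flat m t.
Proof.
move=> t0; rewrite flatE// mulr_gt0 ?expR_gt0//.
by rewrite exprn_gt0// invr_gt0.
Qed.

Lemma flat_ge0 m t : 0 <= flat m t.
Proof. by case: (leP t 0) => [/flat_eq0->//|/(flat_gt0 m)/ltW]. Qed.

Lemma flat0_le1 t : flat 0 t <= 1.
Proof.
rewrite /flat; case: (leP t 0) => // t0.
by rewrite expr0 mul1r -expR0 ler_expR lerNl oppr0 invr_ge0 ltW.
Qed.

(** With s = 1/t and k = m + 2, e^s = (e^(s/k))^k >= (s/k)^k, hence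
s^m e^-s <= k^k / s^2.  The quadratic bound makes the derivative at 0 vanish. *)
Lemma flat_le_sqr m t : flat m t <= m.+2%:R ^+ m.+2 * t ^+ 2.
Proof.
case: (leP t 0) => [/flat_eq0->|t0].
  by rewrite mulr_ge0 ?sqr_ge0 ?exprn_ge0.
rewrite flatE//; set s := t^-1.
have s0 : 0 < s by rewrite invr_gt0.
have -> : t ^+ 2 = s ^- 2 by rewrite /s exprVn invrK.
have k0 : 0 < m.+2%:R :> R by rewrite ltr0n.
have es : (s / m.+2%:R) ^+ m.+2 <= expR s.
  have -> : expR s = expR (s / m.+2%:R) ^+ m.+2.
    by rewrite -expRM_natl mulrC divfK// gt_eqF.
  apply: lerXn2r; rewrite ?nnegrE ?expR_ge0 ?divr_ge0 ?(ltW s0)//.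
  by apply: le_trans (expR_ge1Dx _); rewrite lerDr.
rewrite expRN ler_pdivrMr ?expR_gt0//.
rewrite mulrAC ler_pdivlMr ?exprn_gt0// -exprD addn2.
by rewrite mulrC -ler_pdivrMr ?exprn_gt0// -expr_div_n.
Qed.

Lemma is_derive_flat m t :
  is_derive t 1 (flat m) (flat m.+2 t - m%:R * flat m.+1 t).
Proof.
case: (ltgtP t 0) => [t0|t0|->].
- apply: (@near_eq_is_derive _ _ _ (cst 0)).
    near=> u; rewrite flat_eq0//; apply/ltW; near: u.
    by apply: lt_nbhsl.
  by rewrite !flat_eq0 ?ltW// mulr0 subr0; exact: is_derive_cst.
- apply: (@near_eq_is_derive R R R (fun u => u^-1 ^+ m * expR (- u^-1))).
    near=> u; rewrite flatE//; near: u.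
    by apply: lt_nbhsr.
  have tn0 : t != 0 by rewrite gt_eqF.
  have di : is_derive t 1 (fun u : R => u^-1) (- t^-1 ^+ 2).
    apply: is_derive_eq; first exact: is_deriveV.
    by rewrite [_%:A]mulr1 exprVn.
  have dX := is_deriveX m di.
  have dN := is_deriveN di.
  have dE : is_derive t 1 (expR \o (fun u => - u^-1)) (expR (- t^-1) * t^-1 ^+ 2).
    apply: is_derive1_comp.
    by apply: (is_derive_eq dN); rewrite opprK.
  have := is_deriveM dX dE; rewrite (_ : _ * _ = (fun u => u^-1 ^+ m * expR (- u^-1))).
    move=> h; apply: (is_derive_eq h).
    rewrite !flatE// /GRing.scale/= exprfctE.
    move: (t^-1) (expR _) => w z.
    case: (m) => [|k]; first by rewrite !mul0r mulr0 addr0 subr0 expr0 mul1r mulrC.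
    by rewrite /= !exprS; ring.
  by apply/funext => u; rewrite fctE exprfctE.
- rewrite !flat_eq0// mulr0 subr0.
  (* The difference quotient at 0 is O(|h|) by the quadratic bound. *)
  suff H : (fun h : R => h^-1 *: (flat m (h *: 1 + 0) - flat m 0)) @ 0^' --> (0 : R).
    by apply: DeriveDef; [apply/cvg_ex; exists 0 | apply/cvg_lim => //].
  apply/cvgr0Pnorm_le => e e0; near=> h.
  have hn0 : h != 0 by near: h; exact: nbhs_dnbhs_neq.
  rewrite [h *: 1]mulr1 addr0 (@flat_eq0 _ 0)// subr0 normrM normfV.
  rewrite ler_pdivrMl ?normr_gt0// ger0_norm ?flat_ge0//.
  apply: le_trans (flat_le_sqr _ _) _.
  rewrite -[h ^+ 2]real_normK ?num_real// expr2 mulrCA.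
  rewrite ler_wpM2l// -ler_pdivlMl ?exprn_gt0// ltW//.
  near: h; apply: dnbhs0_lt; by rewrite mulr_gt0// invr_gt0 exprn_gt0.
Unshelve. all: by end_near. Qed.

Lemma continuous_flat m : continuous (flat m).
Proof.
move=> t; apply: differentiable_continuous; apply/derivable1_diffP.
by have [] := is_derive_flat m t.
Qed.

End flat.

Section class_C_theory.
Context {R : realType} (d : nat).
Local Notation Rd := 'rV[R]_d.
Implicit Types f g : Rd -> R.
Local Notation e j := (delta_mx ord0 j : Rd).

Lemma class_C_continuous k f : class_C k f -> continuous f.
Proof. by case: k => [|k] //= -[]. Qed.

Lemma class_CS k f : class_C k.+1 f -> class_C k f.
Proof.
elim: k f => [|k IH] f /=; first by case.
by move=> [cf df]; split=> // j; have [dj cj] := df j; split=> //; exact: IH.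
Qed.

(** Constructor for [class_C] from candidate partial derivatives, which avoids
computing with the total derivation operator. *)
Lemma class_C_step k f (df : 'I_d -> Rd -> R) : continuous f ->
  (forall j x, is_derive x (e j) f (df j x)) ->
  (forall j, class_C k (df j)) -> class_C k.+1 f.
Proof.
move=> cf Hd Cd; split => // j; split; first by move=> x; have [] := Hd j x.
rewrite (_ : partial j f = df j)//.
by apply/funext => x; rewrite /partial; have [_ ->] := Hd j x.
Qed.

Lemma class_C_partial k f j x :
  class_C k.+1 f -> is_derive x (e j) f (partial j f x).
Proof. by case=> _ /(_ j)[/(_ x)df _]; exact: derivableP. Qed.

Lemma class_C_cst k (a : R) : class_C k (cst a : Rd -> R).
Proof.
elim: k a => [|k IH] a; first exact: cst_continuous.
apply: (@class_C_step _ _ (fun _ => cst 0)) => //; exact: cst_continuous.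
Qed.

Lemma class_CD k f g : class_C k f -> class_C k g ->
  class_C k (fun x => f x + g x).
Proof.
elim: k f g => [|k IH] f g Cf Cg.
  move=> x; have cf := class_C_continuous Cf (x := x).
  exact: (cvgD cf (class_C_continuous Cg (x := x))).
apply: (@class_C_step _ _ (fun j x => partial j f x + partial j g x)).
- move=> x; have cf := class_C_continuous Cf (x := x).
  exact: (cvgD cf (class_C_continuous Cg (x := x))).
- by move=> j x; exact: (is_deriveD (class_C_partial j x Cf) (class_C_partial j x Cg)).
- by move=> j; apply: IH; [case: Cf => _ /(_ j)[]|case: Cg => _ /(_ j)[]].
Qed.

Lemma class_CM k f g : class_C k f -> class_C k g ->
  class_C k (fun x => f x * g x).
Proof.
elim: k f g => [|k IH] f g Cf Cg.
  move=> x; have cf := class_C_continuous Cf (x := x).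
  exact: (cvgM cf (class_C_continuous Cg (x := x))).
apply: (@class_C_step _ _ (fun j x => f x * partial j g x + g x * partial j f x)).
- move=> x; have cf := class_C_continuous Cf (x := x).
  exact: (cvgM cf (class_C_continuous Cg (x := x))).
- move=> j x; have Df := class_C_partial j x Cf; have Dg := class_C_partial j x Cg.
  exact: (is_deriveM Df Dg).
- move=> j; apply: class_CD; apply: IH; try exact: class_CS.
  + by case: Cg => _ /(_ j)[].
  + by case: Cf => _ /(_ j)[].
Qed.

Lemma class_C_prod k (I : Type) (r : seq I) (F : I -> Rd -> R) :
  (forall i, class_C k (F i)) -> class_C k (fun x => \prod_(i <- r) F i x).
Proof.
move=> CF; elim: r => [|i r IH].
  rewrite (_ : (fun _ => _) = cst 1); first exact: class_C_cst.
  by apply/funext => x; rewrite big_nil.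
rewrite (_ : (fun _ => _) = (fun x => F i x * \prod_(i <- r) F i x)).
  exact: class_CM.
by apply/funext => x; rewrite big_cons.
Qed.

Lemma class_CX k f n : class_C k f -> class_C k (fun x => f x ^+ n).
Proof.
move=> Cf; elim: n => [|n IH]; first exact: class_C_cst.
rewrite (_ : (fun _ => _) = (fun x => f x * f x ^+ n)); first exact: class_CM.
by apply/funext => x; rewrite exprS.
Qed.

Lemma class_C_flat k m (i : 'I_d) (s a : R) :
  class_C k (fun x : Rd => flat m (s * x ord0 i + a)).
Proof.
have cnt m' : continuous (fun x : Rd => flat m' (s * x ord0 i + a)).
  move=> x; apply: (@continuous_comp _ _ _ (fun x : Rd => s * x ord0 i + a) (flat m')).
    apply: continuousD; last exact: cst_continuous.
    apply: continuousM; first exact: cst_continuous.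
    exact: coord_continuous.
  exact: continuous_flat.
elim: k m => [|k IH] m; first exact: cnt.
apply: (@class_C_step _ _ (fun j x => (s * (j == i)%:R) *
   (flat m.+2 (s * x ord0 i + a) + (- m%:R) * flat m.+1 (s * x ord0 i + a)))).
- exact: cnt.
- move=> j x.
  have H : is_derive (0 : R) 1 (fun h : R => flat m (s * ((h *: e j + x) ord0 i) + a))
     (s * (j == i)%:R *
     (flat m.+2 (s * x ord0 i + a) + - m%:R * flat m.+1 (s * x ord0 i + a))).
    rewrite (_ : (fun _ => _) =
        flat m \o (fun h : R => (s * (j == i)%:R) * h + (s * x ord0 i + a))); last first.
      apply/funext => h /=; congr flat; rewrite !mxE eqxx/= [i == j]eq_sym; ring.
    have Hd : is_derive (0 : R) 1
        (fun h : R => (s * (j == i)%:R) * h + (s * x ord0 i + a)) (s * (j == i)%:R).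
      have Hd := is_deriveD (is_deriveZ (s * (j == i)%:R) (is_derive_id (0:R) 1))
        (is_derive_cst (s * x ord0 i + a) (0 : R) 1).
      by apply: (is_derive_eq Hd); rewrite addr0 [_%:A]mulr1.
    apply: (is_derive_eq (is_derive1_comp (is_derive_flat m _) Hd)).
    by rewrite mulr0 add0r mulrC mulNr.
  have [H1 H2] := H.
  pose f (y : Rd) := flat m (s * y ord0 i + a).
  have df : derivable f x (e j) := iffRL (derivable1P _ _ _) H1.
  apply: (is_derive_eq (derivableP df)).
  rewrite -H2 /derive; set g1 := fun h => h^-1 *: _; set g2 := fun h => h^-1 *: _.
  suff -> : g1 = g2 by [].
  by rewrite /g1 /g2; apply/funext => h /=; rewrite addr0 scale0r add0r [_ *: 1]mulr1.
- move=> j; apply: (class_CM (class_C_cst _ _)).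
  by apply: (class_CD (IH _) (class_CM (class_C_cst _ _) (IH _))).
Qed.

End class_C_theory.

(** * Boxes and test functions that approximate them *)

Lemma mx_norm_coord {R : realType} d (x : 'rV[R]_d) i : `|x ord0 i| <= `|x|.
Proof.
have := mx_normrE x; rewrite -/(mx_norm x) => E.
rewrite [leRHS](E : `|x| = _).
exact: (le_bigmax _ (fun ij : 'I_1 * 'I_d => `|x ij.1 ij.2|) (ord0, i)).
Qed.

Section box.
Context {R : realType} (d : nat).
Local Notation Rd := 'rV[R]_d.
Implicit Types (a b x : Rd) (k : nat).

Definition box a b : set Rd :=
  [set x | forall i, a ord0 i < x ord0 i /\ x ord0 i < b ord0 i].

(** The factors [1 * _] and [- 1 * _] put both arguments in the affine form
under which smoothness of [flat] is proved in [class_C_flat]. *)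
Definition bump a b x : R :=
  \prod_i (flat 0 (1 * x ord0 i + - a ord0 i) * flat 0 (- 1 * x ord0 i + b ord0 i)).

Lemma bump_ge0 a b x : 0 <= bump a b x.
Proof. by apply: prodr_ge0 => i _; rewrite mulr_ge0 ?flat_ge0. Qed.

Lemma bump_le1 a b x : bump a b x <= 1.
Proof.
rewrite /bump; apply: prodr_ile1 => i _.
by rewrite mulr_ge0 ?flat_ge0//= mulr_ile1 ?flat_ge0 ?flat0_le1.
Qed.

Lemma bump_gt0 a b x : box a b x -> 0 < bump a b x.
Proof.
move=> bx; apply: prodr_gt0 => i _; have [ax xb] := bx i.
by rewrite mulr_gt0// flat_gt0//; lra.
Qed.

Lemma bump_eq0 a b x : ~ box a b x -> bump a b x = 0.
Proof.
move=> /existsNP[i /not_andP axb]; apply/eqP; rewrite prodf_seq_eq0.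
apply/hasP; exists i; first by rewrite mem_index_enum.
rewrite /= mulf_eq0; apply/orP.
by case: axb => /negP; rewrite -leNgt => h; [left|right]; apply/eqP/flat_eq0; lra.
Qed.

Lemma measurable_bump a b : measurable_fun setT (bump a b).
Proof.
apply: measurable_prod => i _.
have mc (s c : R) : measurable_fun setT (fun x : Rd => flat 0 (s * x ord0 i + c)).
  apply: (@measurableT_comp _ _ _ _ _ _ (flat 0)).
    by apply: continuous_measurable_fun; exact: continuous_flat.
  apply: measurable_funD => //; apply: measurable_funM => //.
  exact: measurable_rV_coord.
by apply: measurable_funM; exact: mc.
Qed.

Lemma boxE a b : box a b = bump a b @^-1` `]0, +oo[%classic.
Proof.
apply/seteqP; split => x /=; first by rewrite in_itv/= andbT => /bump_gt0.
rewrite in_itv/= andbT; apply: contraPP => /bump_eq0 ->; by rewrite ltxx.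
Qed.

Lemma measurable_box a b : measurable (box a b).
Proof.
by rewrite boxE -[X in measurable X]setTI; exact: measurable_bump.
Qed.

(** A polynomial in the bump is smooth for free, vanishes off the box, and tends
to 1 wherever the bump is positive: this replaces a mollification argument. *)
Definition mollified k a b x : R := 1 - (1 - bump a b x) ^+ k.

Lemma mollified_test_function k a b : test_function (mollified k a b).
Proof.
split=> [m|].
  have C1 : class_C m (cst 1 : Rd -> R) by exact: class_C_cst.
  have CN (f : Rd -> R) : class_C m f -> class_C m (fun x => 1 + (-1) * f x).
    by move=> Cf; exact: (class_CD C1 (class_CM (class_C_cst d m (-1)) Cf)).
  have Cb : class_C m (bump a b).
    by apply: class_C_prod => i; apply: class_CM; exact: class_C_flat.
  rewrite (_ : mollified _ _ _ =
      (fun x => 1 + (-1) * (1 + (-1) * bump a b x) ^+ k)).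
    exact: (CN _ (class_CX _ (CN _ Cb))).
  by apply/funext => x; rewrite /mollified !mulN1r.
pose K := [set x : Rd | forall i, `[a ord0 i, b ord0 i]%classic (x ord0 i)].
have cK : compact K.
  apply: (@rV_compact R d (fun i => `[a ord0 i, b ord0 i]%classic)) => i.
  exact: segment_compact.
apply: (subclosed_compact _ cK); first exact: closed_closure.
rewrite [X in _ `<=` X](closure_id K).1.
  apply: closure_subset => x /= nx i; apply: contrapT => xi.
  move/eqP: nx; apply.
  rewrite /mollified bump_eq0 ?subr0 ?expr1n ?subrr// => /(_ i) [h1 h2].
  by apply: xi; rewrite /= in_itv/= !ltW.
exact: compact_closed.
Qed.

Lemma mollified_eq0 k a b x : ~ box a b x -> mollified k a b x = 0.
Proof. by rewrite /mollified => /bump_eq0 ->; rewrite subr0 expr1n subrr. Qed.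

Lemma mollified_norm_le1 k a b x : `|mollified k a b x| <= 1.
Proof.
have := bump_ge0 a b x; have := bump_le1 a b x; rewrite /mollified => h1 h0.
have p0 : 0 <= (1 - bump a b x) ^+ k by rewrite exprn_ge0// subr_ge0.
have p1 : (1 - bump a b x) ^+ k <= 1 by rewrite exprn_ile1; lra.
by rewrite ler_norml; lra.
Qed.

Lemma cvg_mollified a b x : box a b x ->
  mollified k a b x @[k --> \oo] --> (1 : R).
Proof.
move=> /bump_gt0 b0; have b1 := bump_le1 a b x.
rewrite -[X in _ --> X]subr0; apply: cvgB; first exact: cvg_cst.
by apply: cvg_expr; rewrite ger0_norm; lra.
Qed.

Lemma measurable_mollified k a b : measurable_fun setT (mollified k a b).
Proof.
apply: measurable_funB => //; apply: measurable_funX; apply: measurable_funB => //.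
exact: measurable_bump.
Qed.

End box.

Lemma lebesgue_box {R : realType} d (a b : 'rV[R]_d) :
  (lebesgue_rV d (box a b) < +oo)%E.
Proof.
elim: d a b => [|d IH] a b.
  rewrite /= /dirac indicE; exact: ltry.
rewrite /= /lebesgue_step /pushforward.
have -> : @rV_cons R d @^-1` box a b =
    `]a ord0 ord0, b ord0 ord0[%classic `*` box (rV_behead a) (rV_behead b).
  apply/seteqP; split => -[x v] /=.
    move=> abx; split.
      by have := abx ord0; rewrite !mxE unlift_none/= in_itv/= => -[-> ->].
    by move=> i; have := abx (lift ord0 i); rewrite !mxE liftK.
  rewrite in_itv/= => -[/andP[x1 x2] h] i; rewrite !mxE.
  by case: (unliftP ord0 i) => [j ->|->//]; have := h j; rewrite !mxE.
rewrite product_measure1E//; last exact: measurable_box.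
have fin1 : lebesgue_measure `]a ord0 ord0, b ord0 ord0[%classic \is a fin_num.
  by rewrite lebesgue_measure_itv/=; case: ifPn.
by apply: lte_mul_pinfty; [exact: measure_ge0|exact: fin1|exact: IH].
Qed.

Section rV_generators.
Context {R : realType} (d : nat).
Local Notation Rd := 'rV[R]_d.

Definition upper_orthants : set (set Rd) :=
  range (fun a : Rd => [set x : Rd | forall i, a ord0 i < x ord0 i]).

Lemma upper_orthants_setI : setI_closed upper_orthants.
Proof.
move=> _ _ [a _ <-] [b _ <-].
exists (\row_i Num.max (a ord0 i) (b ord0 i)) => //.
apply/seteqP; split=> x /=.
  by move=> h; split=> i; have := h i; rewrite mxE gt_max => /andP[].
by move=> [h1 h2] i; rewrite mxE gt_max h1 h2.
Qed.

(** A half-space x_i > c is the countable union over k of the orthants with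
corner c in direction i and -k in the others. *)
Lemma measurable_rV_orthants : @measurable _ Rd = <<s upper_orthants >>.
Proof.
apply/seteqP; split; last first.
  apply: smallest_sub; first exact: sigma_algebra_measurable.
  move=> _ [a _ <-].
  rewrite (_ : [set x : Rd | _] = \bigcup_k box a (const_mx k%:R)).
    by apply: bigcup_measurable => k _; exact: measurable_box.
  apply/seteqP; split => [x ax|x [k _ bx] i]; last by have [] := bx i.
  have [k kx] : exists k : nat, `|x| < k%:R.
    by exists (Num.truncn `|x|).+1; rewrite truncnS_gt.
  exists k => // i; split; first exact: ax.
  by rewrite mxE (le_lt_trans _ kx)// (le_trans (ler_norm _))// mx_norm_coord.
apply: smallest_sub; first exact: smallest_sigma_algebra.
have coord_meas i : measurable_fun setT
    (fun x : g_sigma_algebraType upper_orthants => (x : Rd) ord0 i).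
  apply: (measurability _ (RGenOInfty.measurableE R)).
  move=> _ [_ [c ->] <-]; rewrite setTI.
  rewrite (_ : _ @^-1` _ = \bigcup_k
      [set x : Rd | forall j, (\row_j (if j == i then c else - k%:R)) ord0 j < x ord0 j]).
    apply: bigcup_measurable => k _; apply: sub_sigma_algebra.
    by exists (\row_j (if j == i then c else - k%:R)).
  apply/seteqP; split => [x /=|x [k _ /(_ i)]/=]; rewrite ?mxE ?eqxx in_itv/= andbT//.
  move=> cx.
  exists (Num.truncn `|x : Rd|).+1 => // j /=; rewrite mxE; case: eqP => [->//|_].
  rewrite ltrNl (le_lt_trans _ (truncnS_gt _))//.
  by rewrite (le_trans (ler_norm _))// normrN mx_norm_coord.
elim/big_ind: _ => [//|A B hA hB|i _]; first by rewrite subUset.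
move=> _ [B mB <-]; exact: coord_meas.
Qed.

End rV_generators.

(** * The fundamental lemma of the calculus of variations *)

Lemma Lfun_measurable d (T : measurableType d) (R : realType)
    (nu : {measure set T -> \bar R}) q (h : T -> R) :
  h \in Lfun nu q -> measurable_fun setT h.
Proof. by rewrite inE => /andP[/[!inE]]. Qed.

Section fundamental_lemma.
Context {R : realType} (d : nat).
Local Notation Rd := 'rV[R]_d.
Local Notation mu := (@lebesgue_rV R d).
Implicit Types (h : Rd -> R) (a b : Rd).

(** Boxes have finite measure and |h| <= 1 + h^2. *)
Lemma Lfun2_integrable_box h a b : h \in Lfun mu 2%:E ->
  mu.-integrable (box a b) (EFin \o h).
Proof.
move=> h2; have mB := measurable_box a b; have mh := Lfun_measurable h2.
have i1 : mu.-integrable (box a b) (EFin \o cst 1).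
  apply/integrableP; split; first exact/measurable_EFinP.
  under eq_integral do rewrite /= normr1.
  by rewrite integral_cst//= mul1e; exact: lebesgue_box.
have i2 : mu.-integrable (box a b) (EFin \o (fun x => h x ^+ 2)).
  by apply: (integrableS measurableT) => //; exact: Lfun2_integrable_sqr.
apply: le_integrable (integrableD mB i1 i2) => //.
  by apply/measurable_EFinP; exact: measurable_funS mh.
move=> x _ /=; rewrite lee_fin [leRHS]ger0_norm ?addr_ge0 ?sqr_ge0//.
have := sqr_ge0 (`|h x| - 1); rewrite sqrrB1 real_normK ?num_real//.
have := normr_ge0 (h x); lra.
Qed.

Lemma integrable_mollified h k a b : h \in Lfun mu 2%:E ->
  mu.-integrable setT (fun x => (h x * mollified k a b x)%:E).
Proof.
move=> h2; have mB := measurable_box a b; have mh := Lfun_measurable h2.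
rewrite (_ : (fun _ => _) = (fun x => (h x * mollified k a b x)%:E) \_ (box a b)).
  apply/(integrable_mkcond _ mB).1.
  apply: le_integrable (Lfun2_integrable_box a b h2) => //.
    apply/measurable_EFinP; apply: measurable_funTS.
    by apply: measurable_funM => //; exact: measurable_mollified.
  move=> x _ /=; rewrite lee_fin normrM ler_piMr//.
  exact: mollified_norm_le1.
apply/funext => x; rewrite patchE; case: ifPn => // /negP; rewrite inE => nb.
by rewrite mollified_eq0// mulr0.
Qed.

(** Dominated convergence, with dominating function |h| on the box. *)
Lemma weakly_zero_box h a b : h \in Lfun mu 2%:E ->
  (forall k a b, \int[mu]_x (h x * mollified k a b x) = 0) ->
  (\int[mu]_(x in box a b) (h x)%:E = 0)%E.
Proof.
move=> h2 h0; have mB := measurable_box a b; have mh := Lfun_measurable h2.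
have ih := Lfun2_integrable_box a b h2.
pose F k x := (h x * mollified k a b x)%:E.
have mF k : measurable_fun (box a b) (F k).
  apply/measurable_EFinP; apply: measurable_funS (measurableT) _ _ => //.
  by apply: measurable_funM => //; exact: measurable_mollified.
have cF : {ae mu, forall x, box a b x -> F ^~ x @ \oo --> (EFin \o h) x}.
  apply: aeW => x bx; apply: cvg_EFin; first exact: nearW.
  rewrite -[X in _ --> X]mulr1; apply: cvgM; first exact: cvg_cst.
  exact: cvg_mollified.
have bF : {ae mu, forall x k, box a b x -> (`|F k x| <= (abse \o (EFin \o h)) x)%E}.
  apply: aeW => x k bx; rewrite /F/= lee_fin normrM ler_piMr//.
  exact: mollified_norm_le1.
have [_ _] := dominated_convergence mB mF (measurable_int _ ih) cF
  (integrable_abse ih) bF.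
rewrite (_ : (fun _ => _) = cst 0%E); last first.
  apply/funext => k /=.
  have iF : mu.-integrable (box a b) (F k).
    exact: (integrableS measurableT mB (@subsetT _ _) (integrable_mollified k a b h2)).
  rewrite -[LHS]fineK; last exact: integrable_fin_num.
  congr EFin; rewrite -[RHS](h0 k a b).
  rewrite /Rintegral; congr fine; rewrite [LHS]integral_mkcond; apply: eq_integral => x _.
  rewrite patchE /F; case: ifPn => // /negP; rewrite inE => nb.
  by rewrite mollified_eq0// mulr0.
move=> /cvg_lim <-; last exact: ereal_hausdorff.
by apply: cvg_lim; [exact: ereal_hausdorff|exact: cvg_cst].
Qed.

(** Upper orthants form a pi-system that generates the Borel sets and meet a box
in a box, so the previous lemma starts a Dynkin induction. *)
Lemma weakly_zero_box_measurable h (N : R) (A : set Rd) : h \in Lfun mu 2%:E ->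
  (forall k a b, \int[mu]_x (h x * mollified k a b x) = 0) ->
  measurable A ->
  (\int[mu]_(x in box (const_mx (- N)%R) (const_mx N) `&` A) (h x)%:E = 0)%E.
Proof.
move=> h2 h0; set B := box _ _.
have mB : measurable B := measurable_box _ _; have mh := Lfun_measurable h2.
have ih : mu.-integrable B (EFin \o h) := Lfun2_integrable_box _ _ h2.
have mEh D : measurable_fun D (EFin \o h).
  by apply/measurable_EFinP; exact: measurable_funTS.
have B0 : (\int[mu]_(x in B) (h x)%:E = 0)%E := weakly_zero_box _ _ h2 h0.
move=> mA; have {mA} : <<s @upper_orthants R d >> A by rewrite -measurable_rV_orthants.
pose P (E : set Rd) := (\int[mu]_(x in B `&` E) (h x)%:E = 0)%E.
move: A; apply: (@dynkin_induction _ Rd (@upper_orthants R d) P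
  (@measurable_rV_orthants R d)
  (@upper_orthants_setI R d)); rewrite /P.
- by rewrite setIT.
- move=> _ [a _ <-] /=.
  rewrite (_ : B `&` _ = box (\row_i Num.max (- N) (a ord0 i)) (const_mx N)).
    exact: weakly_zero_box.
  apply/seteqP; split=> x /=.
    by move=> [Bx ax] i; have := Bx i; rewrite !mxE gt_max => -[-> ->]; rewrite ax.
  move=> bx; split=> i; have := bx i; rewrite !mxE gt_max => -[/andP[]]//.
(* Complements are taken inside the box. *)
- move=> S mS S0; move: B0.
  rewrite -{1}(setIT B) -(setUv S) setIUr integral_setU//.
  + by rewrite S0 add0e.
  + exact: measurableI.
  + by apply: measurableI => //; exact: measurableC.
  + by apply/disj_setPS => x [[_ Sx] [_]].
- move=> F mF tF F0; rewrite setI_bigcupr integral_bigcup//.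
  + by rewrite eseries0.
  + by apply: trivIset_setIl.
  + by move=> k; exact: measurableI.
  + apply: (integrableS mB) => //.
      by apply: bigcup_measurable => k _; exact: measurableI.
    by move=> x [k _ []].
Qed.

Lemma weakly_zero h : h \in Lfun mu 2%:E ->
  (forall k a b, \int[mu]_x (h x * mollified k a b x) = 0) ->
  {ae mu, forall x, h x = 0}.
Proof.
move=> h2 h0.
pose B k : set Rd := box (const_mx (- k%:R)) (const_mx k%:R).
have : {ae mu, forall x k, B k x -> h x = 0}.
  apply/ae_foralln => k.
  have ae0 : ae_eq mu (B k) (EFin \o h) (cst 0%E).
    apply: integral_ae_eq => //.
    + exact: measurable_box.
    + exact: Lfun2_integrable_box.
    + move=> E EB mE; rewrite integral0 -(setIidr EB).
      exact: weakly_zero_box_measurable.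
  by apply: filterS ae0 => x h0x Bx; have [] := h0x Bx.
apply: filterS => x hx; apply: (hx (Num.truncn `|x|).+1) => i.
have : `|x ord0 i| < (Num.truncn `|x|).+1%:R.
  by rewrite (le_lt_trans (mx_norm_coord _ _))// truncnS_gt.
by rewrite !mxE ltr_norml => /andP[].
Qed.

(** The fundamental lemma of the calculus of variations in L^2. *)
Lemma ae_eq_test_function h1 h2 : h1 \in Lfun mu 2%:E -> h2 \in Lfun mu 2%:E ->
  (forall eta, test_function eta ->
    \int[mu]_x (h1 x * eta x) = \int[mu]_x (h2 x * eta x)) ->
  {ae mu, forall x, h1 x = h2 x}.
Proof.
move=> L1 L2 h12.
have : {ae mu, forall x, (h1 - h2) x = 0}.
  apply: weakly_zero => [|k a b]; first (apply: rpredB => //; by rewrite lee_fin ler1n).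
  under eq_Rintegral do rewrite mulrBl.
  rewrite RintegralB//; try exact: integrable_mollified.
  by rewrite h12 ?subrr//; exact: mollified_test_function.
by apply: filterS => x /eqP; rewrite subr_eq0 => /eqP.
Qed.

End fundamental_lemma.

(** * Positive homogeneity of the integral *)

Section integral_scaling.
Context d (T : measurableType d) (R : realType) (nu : {measure set T -> \bar R}).
Local Open Scope ereal_scope.

Import HBNNSimple.

Lemma ge0_integralZl_ge (c : R) (f : T -> \bar R) : (0 < c)%R ->
  (forall x, 0 <= f x) -> c%:E * \int[nu]_x f x <= \int[nu]_x (c%:E * f x).
Proof.
move=> c0 f0; have cf0 x : 0 <= c%:E * f x by rewrite mule_ge0// lee_fin ltW.
rewrite !ge0_integralTE// -ereal_sup_pZl//.
apply: ge_ereal_sup => _ [_ [h hf <-] <-].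
apply: ereal_sup_ubound; exists (scale_nnsfun h (ltW c0)).
  by move=> x /=; rewrite EFinM lee_pmul2l.
by rewrite -sintegralrM.
Qed.

Lemma ge0_integralZl_gt0 (c : R) (f : T -> \bar R) : (0 < c)%R ->
  (forall x, 0 <= f x) -> \int[nu]_x (c%:E * f x) = c%:E * \int[nu]_x f x.
Proof.
move=> c0 f0; have cf0 x : 0 <= c%:E * f x by rewrite mule_ge0// lee_fin ltW.
apply/eqP; rewrite eq_le ge0_integralZl_ge// andbT.
rewrite -lee_pdivrMl//; apply: le_trans (ge0_integralZl_ge _ cf0) _.
  by rewrite invr_gt0.
by under eq_integral do rewrite muleA -EFinM mulVf ?gt_eqF// mul1e.
Qed.

(** No measurability is assumed, so that the lemma applies to the product of a
function with a derivative of an arbitrary test function.  For c > 0 it holds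
because multiplication by c maps the nonnegative simple functions below the
positive or negative part of f onto those below the same part of c f. *)
Lemma integralZl_gt0 (c : R) (f : T -> \bar R) : (0 < c)%R ->
  \int[nu]_x (c%:E * f x) = c%:E * \int[nu]_x f x.
Proof.
move=> c0; rewrite integralE [in RHS]integralE.
rewrite (ge0_funeposM _ (ltW c0)) (ge0_funenegM _ (ltW c0)).
rewrite !ge0_integralZl_gt0//.
move: (integral _ _ _) (integral _ _ _) => [a| |] [b| |];
  rewrite ?gt0_muley ?gt0_muleNy//= -?EFinM -?EFinB//= ?mulrBr//
    ?gt0_muley ?gt0_muleNy//.
Qed.

Lemma RintegralZl_gt0 (c : R) (f : T -> R) : (0 < c)%R ->
  (\int[nu]_x (c * f x) = c * \int[nu]_x f x)%R.
Proof.
move=> c0; rewrite /Rintegral.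
under eq_integral do rewrite EFinM.
rewrite integralZl_gt0//; case: (integral _ _ _) => [a| |]//=.
  by rewrite gt0_muley//= mulr0.
by rewrite gt0_muleNy//= mulr0.
Qed.

End integral_scaling.

(** * Weak derivatives and positive dilation of values *)

Section sobolev_scaling.
Context {R : realType} (d : nat).
Local Notation Rd := 'rV[R]_d.
Local Notation mu := (@lebesgue_rV R d).
Implicit Types (f g : Rd -> R[i]) (c : R).

Definition cscale c f : Rd -> R[i] := fun x => c%:C%C * f x.

Lemma ReZ c (z : R[i]) : Re (c%:C%C * z) = c * Re z.
Proof. by case: z => a b /=; rewrite mul0r subr0. Qed.

Lemma ImZ c (z : R[i]) : Im (c%:C%C * z) = c * Im z.
Proof. by case: z => a b /=; rewrite mul0r addr0. Qed.

Lemma cabs_sqr (z : R[i]) : cabs z ^+ 2 = Re z ^+ 2 + Im z ^+ 2.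
Proof. by case: z => a b; rewrite sqr_sqrtr// addr_ge0 ?sqr_ge0. Qed.

Lemma cabsZ c (z : R[i]) : 0 <= c -> cabs (c%:C%C * z) = c * cabs z.
Proof.
by move=> c0; rewrite /cabs ComplexField.Normc.normcM /= expr0n/= addr0 sqrtr_sqr ger0_norm.
Qed.

Lemma L2_cscale c f : L2 f -> L2 (cscale c f).
Proof.
move=> [Rf If]; split.
  rewrite (_ : _ \o _ = c \o* (Re \o f)); first by rewrite Lfun_scale// ler1n.
  by apply/funext => x /=; rewrite ReZ mulrC.
rewrite (_ : _ \o _ = c \o* (Im \o f)); first by rewrite Lfun_scale// ler1n.
by apply/funext => x /=; rewrite ImZ mulrC.
Qed.

Lemma Cintegral_cscale c f : 0 < c ->
  Cintegral (cscale c f) = c%:C%C * Cintegral f.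
Proof.
move=> c0; rewrite /Cintegral /cscale.
under eq_Rintegral do rewrite ReZ.
rewrite RintegralZl_gt0//.
under [X in Complex _ X]eq_Rintegral do rewrite ImZ.
rewrite RintegralZl_gt0//.
by apply/eqP; rewrite eq_complex ReZ ImZ !eqxx.
Qed.

Lemma is_weak_partial_cscale j c f g : 0 < c ->
  is_weak_partial j f g -> is_weak_partial j (cscale c f) (cscale c g).
Proof.
move=> c0 fg eta teta; have E h : (fun x : Rd => cscale c h x * (eta x)%:C%C) =
    cscale c (fun x => h x * (eta x)%:C%C).
  by apply/funext => x; rewrite /cscale mulrA.
rewrite E Cintegral_cscale// -mulrN -fg// -Cintegral_cscale//.
by congr Cintegral; apply/funext => x; rewrite /cscale mulrA.
Qed.

Lemma H1_cscale c f : 0 < c -> H1 f -> H1 (cscale c f).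
Proof.
move=> c0 [L2f df]; split; first exact: L2_cscale.
move=> j; have [g [L2g fg]] := df j; exists (cscale c g).
by split; [exact: L2_cscale|exact: is_weak_partial_cscale].
Qed.

Lemma weak_partialP j f : H1 f ->
  L2 (weak_partial j f) /\ is_weak_partial j f (weak_partial j f).
Proof. by move=> [_ /(_ j) /(@xgetPex _ (fun=> 0))]. Qed.

(** Testing against real functions separates real and imaginary parts, and each
falls under the fundamental lemma. *)
Lemma weak_partial_unique j f g1 g2 : L2 g1 -> L2 g2 ->
  is_weak_partial j f g1 -> is_weak_partial j f g2 ->
  {ae mu, forall x, g1 x = g2 x}.
Proof.
move=> [Rg1 Ig1] [Rg2 Ig2] w1 w2.
have w12 eta : test_function eta ->
    Cintegral (fun x => g1 x * (eta x)%:C%C) = Cintegral (fun x => g2 x * (eta x)%:C%C).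
  by move=> te; apply: oppr_inj; rewrite -w1// w2.
have Re_Cintegral g (eta : Rd -> R) :
    Re (Cintegral (fun x => g x * (eta x)%:C%C)) = \int[mu]_x ((Re \o g) x * eta x).
  by apply: eq_Rintegral => x _; rewrite mulrC ReZ mulrC.
have Im_Cintegral g (eta : Rd -> R) :
    Im (Cintegral (fun x => g x * (eta x)%:C%C)) = \int[mu]_x ((Im \o g) x * eta x).
  by apply: eq_Rintegral => x _; rewrite mulrC ImZ mulrC.
have HR : {ae mu, forall x, (Re \o g1) x = (Re \o g2) x}.
  by apply: ae_eq_test_function => // eta te; rewrite -!Re_Cintegral w12.
have HI : {ae mu, forall x, (Im \o g1) x = (Im \o g2) x}.
  by apply: ae_eq_test_function => // eta te; rewrite -!Im_Cintegral w12.
apply: filterS2 HR HI => x hr hi.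
by apply/eqP; rewrite eq_complex; move: hr hi => /= -> ->; rewrite !eqxx.
Qed.

Lemma weak_partial_cscale j c f : 0 < c -> H1 f ->
  {ae mu, forall x, weak_partial j (cscale c f) x = cscale c (weak_partial j f) x}.
Proof.
move=> c0 H1f; have [L2g fg] := weak_partialP j H1f.
have [L2cg cfcg] := weak_partialP j (H1_cscale c0 H1f).
apply: weak_partial_unique cfcg _ => //; first exact: L2_cscale.
exact: is_weak_partial_cscale.
Qed.

Lemma L2_integrable_cabs_sqr f : L2 f ->
  mu.-integrable setT (fun x => (cabs (f x) ^+ 2)%:E).
Proof.
move=> [Rf If]; under eq_fun do rewrite cabs_sqr EFinD.
by apply: integrableD => //; exact: Lfun2_integrable_sqr.
Qed.

Lemma integrable_grad_sq f : H1 f ->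
  mu.-integrable setT (fun x => (grad_sq f x)%:E).
Proof.
move=> H1f; rewrite /grad_sq; under eq_fun do rewrite -sumEFin.
apply: integrable_sum => // j _.
exact: (L2_integrable_cabs_sqr (weak_partialP j H1f).1).
Qed.

Lemma grad_sq_ge0 f x : 0 <= grad_sq f x.
Proof. by apply: sumr_ge0 => j _; exact: sqr_ge0. Qed.

Lemma Rintegral_ae_eq (u v : Rd -> R) :
  measurable_fun setT u -> measurable_fun setT v ->
  {ae mu, forall x, u x = v x} -> \int[mu]_x u x = \int[mu]_x v x.
Proof.
move=> mu_ mv uv; congr fine; apply: ae_eq_integral => //.
- exact/measurable_EFinP.
- exact/measurable_EFinP.
- by apply: filterS uv => x -> .
Qed.

(** The exceptional null sets, one for each direction, are merged. *)
Lemma grad_sq_cscale c f : 0 < c -> H1 f ->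
  {ae mu, forall x, grad_sq (cscale c f) x = c ^+ 2 * grad_sq f x}.
Proof.
move=> c0 H1f.
have : {ae mu, forall x j, weak_partial j (cscale c f) x = cscale c (weak_partial j f) x}.
  have H k : {ae mu, forall x (j : 'I_d), j = k :> nat ->
      weak_partial j (cscale c f) x = cscale c (weak_partial j f) x}.
    case: (ltnP k d) => [kd|dk].
      apply: filterS (weak_partial_cscale (Ordinal kd) c0 H1f) => x hx j jk.
      by rewrite (_ : j = Ordinal kd)//; exact: val_inj.
    by apply: aeW => x j jk; move: dk; rewrite -jk leqNgt ltn_ord.
  by apply: filterS (ae_foralln H) => x hx j; exact: (hx j j).
apply: filterS => x hx; rewrite /grad_sq mulr_sumr; apply: eq_bigr => j _.
by rewrite hx cabsZ ?ltW// exprMn.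
Qed.

Lemma Rintegral_grad_sq_cscale c f : 0 < c -> H1 f ->
  \int[mu]_x grad_sq (cscale c f) x = c ^+ 2 * \int[mu]_x grad_sq f x.
Proof.
move=> c0 H1f; have mg (h : Rd -> R[i]) : H1 h -> measurable_fun setT (grad_sq h).
  by move=> /integrable_grad_sq /measurable_int /measurable_EFinP.
rewrite -RintegralZl_gt0 ?exprn_gt0//; apply: Rintegral_ae_eq.
- exact: (mg _ (H1_cscale c0 H1f)).
- by apply: measurable_funM => //; exact: mg.
- exact: grad_sq_cscale.
Qed.

(** Also valid when the norm is infinite, as both sides are then 0. *)
Lemma CLnorm_cscale q c f : 0 < c -> q != 0 ->
  CLnorm q (cscale c f) = c * CLnorm q f.
Proof.
move=> c0 q0; rewrite /CLnorm unlock.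
under eq_integral do rewrite /= cabsZ ?ltW// normrM powRM// EFinM.
rewrite integralZl_gt0 ?powR_gt0 ?normr_gt0 ?gt_eqF//.
rewrite poweRM ?lee_fin ?powR_ge0//; last first.
  by apply: integral_ge0 => x _; rewrite lee_fin powR_ge0.
rewrite poweR_EFin -powRrM mulfV// powRr1// gtr0_norm//.
case: (_ `^ _)%E => [r| |] //=.
  by rewrite gt0_muley//= mulr0.
by rewrite gt0_muleNy//= mulr0.
Qed.

(** Also valid when the norm is infinite, as both sides are then 0. *)
Lemma CLnorm2_sqr f : CLnorm 2 f ^+ 2 = \int[mu]_x (cabs (f x) ^+ 2).
Proof.
rewrite /CLnorm /Rintegral.
rewrite (_ : (\int[mu]_x (cabs (f x) ^+ 2)%:E = 'N[mu]_2%:E[EFin \o cabs \o f] `^ 2)%E).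
  case: ('N[mu]_2%:E[_])%E (Lnorm_ge0 mu 2%:E (EFin \o cabs \o f)) => [r| |]// r0.
    by rewrite poweR_EFin/= powR_mulrn.
  by rewrite poweRyr// expr0n.
rewrite poweR_Lnorm//; apply: eq_integral => x _ /=.
by rewrite powR_mulrn// real_normK ?num_real.
Qed.

End sobolev_scaling.

(** * Action and energy ground states *)

Section ground_state_theory.
Context {R : realType} (n : nat).
Local Notation Rd := 'rV[R]_n.+2.
Local Notation mu := (@lebesgue_rV R n.+2).
Local Notation i1 := (ord0 : 'I_n.+2).
Local Notation i2 := (lift ord0 ord0 : 'I_n.+2).
Implicit Types (V : Rd -> R) (p Omega omega m c : R) (phi : Rd -> R[i]).

(** This growth makes x_1 phi and x_2 phi square integrable for phi in the energy
space. *)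
Definition coord_sqr_dominated V : Prop := exists A B : R,
  [/\ 0 <= A, 0 <= B & forall x : Rd, x ord0 i1 ^+ 2 <= A * V x + B /\
                                      x ord0 i2 ^+ 2 <= A * V x + B].

(** Fix gamma > 0 such that V - gamma^2/2 (x_1^2 + x_2^2) tends to infinity.  This
difference is nonnegative for |x| > r, which bounds x_j^2 by 2/gamma^2 V there,
while x_j^2 <= r^2 for |x| <= r. *)
Lemma Omega_max_coord_sqr_dominated V : (forall x, 0 <= V x) ->
  (0 < Omega_max V)%E -> coord_sqr_dominated V.
Proof.
move=> V0 /ereal_sup_gt[_ [gamma [_ gV] <-]]; rewrite lte_fin => g0.
have [r Hr] := gV _ (nbhs_pinfty_ge (num_real (0 : R))).
have g2 : 0 < gamma ^+ 2 / 2 by rewrite divr_gt0// exprn_gt0.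
exists (gamma ^+ 2 / 2)^-1, (r ^+ 2); split; rewrite ?invr_ge0 ?(ltW g2) ?sqr_ge0//.
have H (x : Rd) j : j = i1 \/ j = i2 ->
    x ord0 j ^+ 2 <= (gamma ^+ 2 / 2)^-1 * V x + r ^+ 2.
  move=> j12; have [rx|xr] := ltP r `|x|.
    have /= := Hr _ rx; rewrite subr_ge0 => h.
    rewrite -[leLHS]addr0 lerD ?sqr_ge0// mulrC ler_pdivlMr// mulrC.
    apply: le_trans h; rewrite ler_wpM2l ?(ltW g2)//.
    by case: j12 => ->; rewrite ?lerDl ?lerDr sqr_ge0.
  rewrite -[leLHS]add0r lerD ?mulr_ge0 ?invr_ge0 ?(ltW g2)//.
  rewrite -real_normK ?num_real// -[leRHS]real_normK ?num_real//.
  have xj := le_trans (mx_norm_coord x j) xr.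
  by rewrite lerXn2r ?nnegrE// (le_trans xj)// ler_norm.
by move=> x; split; apply: H; [left|right].
Qed.

Lemma integrable_mul_sqr d (T : measurableType d) (nu : {measure set T -> \bar R})
    (f g : T -> R) :
  measurable_fun setT f -> measurable_fun setT g ->
  nu.-integrable setT (fun x => (f x ^+ 2)%:E) ->
  nu.-integrable setT (fun x => (g x ^+ 2)%:E) ->
  nu.-integrable setT (fun x => (f x * g x)%:E).
Proof.
move=> mf mg f2 g2; apply: le_integrable (integrableD measurableT f2 g2) => //.
  by apply/measurable_EFinP; exact: measurable_funM.
move=> x _ /=; rewrite lee_fin [leRHS]ger0_norm ?addr_ge0 ?sqr_ge0// normrM.
rewrite -[f x ^+ 2]real_normK ?num_real// -[g x ^+ 2]real_normK ?num_real//.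
have := sqr_ge0 (`|f x| - `|g x|); have := mulr_ge0 (normr_ge0 (f x)) (normr_ge0 (g x)).
nra.
Qed.

Lemma integrable_coord_sqr V phi j (u : Rd -> R) : (j = i1 \/ j = i2) ->
  coord_sqr_dominated V -> energy_space V phi -> measurable_fun setT u ->
  (forall x, u x ^+ 2 <= cabs (phi x) ^+ 2) ->
  mu.-integrable setT (fun x => ((x ord0 j * u x) ^+ 2)%:E).
Proof.
move=> j12 [A [B [A0 B0 AB]]] [[L2phi _] iV] mu_ uphi.
have iVA := integrableZl measurableT A iV.
have iB := integrableZl measurableT B (L2_integrable_cabs_sqr L2phi).
apply: le_integrable (integrableD measurableT iVA iB) => //.
  apply/measurable_EFinP; apply: measurable_funX; apply: measurable_funM => //.
  exact: measurable_rV_coord.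
move=> x _ /=; rewrite lee_fin ger0_norm ?sqr_ge0//.
apply: le_trans (ler_norm _); rewrite mulrA -mulrDl exprMn.
apply: ler_pM; rewrite ?sqr_ge0//.
by have [h1 h2] := AB x; case: j12 => ->.
Qed.

Lemma measurable_L2 f : L2 f ->
  measurable_fun setT (fun x : Rd => Re (f x)) /\
  measurable_fun setT (fun x : Rd => Im (f x)).
Proof. by move=> [/Lfun_measurable ? /Lfun_measurable ?]. Qed.

(** The density is a combination of products of x_j phi with weak derivatives,
two square integrable factors. *)
Lemma integrable_angular V phi : coord_sqr_dominated V -> energy_space V phi ->
  mu.-integrable setT (fun x => (Re ((phi x)^*%C * Lz phi x))%:E).
Proof.
move=> Vd X; have [H1phi iV] := X; have [L2phi _] := H1phi.
have [mR mI] := measurable_L2 L2phi.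
have wL j := (weak_partialP j H1phi).1.
have cR (x : Rd) : Re (phi x) ^+ 2 <= cabs (phi x) ^+ 2 by rewrite cabs_sqr lerDl sqr_ge0.
have cI (x : Rd) : Im (phi x) ^+ 2 <= cabs (phi x) ^+ 2 by rewrite cabs_sqr lerDr sqr_ge0.
have prod j k (u v : Rd -> R) : (j = i1 \/ j = i2) -> measurable_fun setT u ->
    (forall x, u x ^+ 2 <= cabs (phi x) ^+ 2) ->
    v \in Lfun mu 2%:E ->
    mu.-integrable setT (fun x => (k * (x ord0 j * u x * v x))%:E).
  move=> j12 mu_ uphi Lv.
  have muj : measurable_fun setT (fun x : Rd => x ord0 j * u x).
    by apply: measurable_funM => //; exact: measurable_rV_coord.
  exact: (integrableZl measurableT k (integrable_mul_sqr muj (Lfun_measurable Lv)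
    (integrable_coord_sqr j12 Vd X mu_ uphi) (Lfun2_integrable_sqr Lv))).
have P1 := prod i1 1 _ _ (or_introl erefl) mR cR (wL i2).2.
have P2 := prod i2 (-1) _ _ (or_intror erefl) mR cR (wL i1).2.
have P3 := prod i2 1 _ _ (or_intror erefl) mI cI (wL i1).1.
have P4 := prod i1 (-1) _ _ (or_introl erefl) mI cI (wL i2).1.
apply: eq_integrable (integrableD measurableT (integrableD measurableT P1 P2)
  (integrableD measurableT P3 P4)) => //.
move=> x _ /=; rewrite -!EFinD; congr EFin; rewrite /Lz.
case: (phi x) (weak_partial i1 phi x) (weak_partial i2 phi x) => [a b] [u v] [s t] /=.
ring.
Qed.

Definition quadratic_energy V Omega phi : R :=
  2^-1 * \int[mu]_x grad_sq phi x + \int[mu]_x (V x * cabs (phi x) ^+ 2)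
  - Omega * \int[mu]_x (Re ((phi x)^*%C * Lz phi x)).

Lemma energyE V p Omega phi : energy V p Omega phi =
  quadratic_energy V Omega phi + 2 / (p + 1) * CLnorm (p + 1) phi `^ (p + 1).
Proof. by rewrite /energy /quadratic_energy /= addrAC. Qed.

Lemma rayleighE V Omega phi : coord_sqr_dominated V -> energy_space V phi ->
  rayleigh V Omega phi = quadratic_energy V Omega phi / mass phi.
Proof.
move=> Vd X; have [H1phi iV] := X; congr (_ / _).
have ig := integrable_grad_sq H1phi; have ia := integrable_angular Vd X.
have ig2 := integrableZl measurableT 2^-1 ig.
have ia2 := integrableZl measurableT Omega ia.
rewrite RintegralB//; last exact: (integrableD measurableT ig2 iV).
by rewrite RintegralD// !RintegralZl.
Qed.

Lemma energy_space_cscale V c phi : 0 < c ->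
  energy_space V phi -> energy_space V (cscale c phi).
Proof.
move=> c0 [H1phi iV]; split; first exact: H1_cscale.
apply: eq_integrable (integrableZl measurableT (c ^+ 2) iV) => // x _ /=.
by rewrite -EFinM; congr EFin; rewrite cabsZ ?ltW// exprMn mulrCA.
Qed.

Lemma quadratic_energy_cscale V Omega c phi : coord_sqr_dominated V ->
  energy_space V phi -> 0 < c ->
  quadratic_energy V Omega (cscale c phi) = c ^+ 2 * quadratic_energy V Omega phi.
Proof.
move=> Vd X c0; have [H1phi iV] := X; have cX := energy_space_cscale c0 X.
have mang psi : energy_space V psi ->
    measurable_fun setT (fun x => Re ((psi x)^*%C * Lz psi x)).
  by move=> /(integrable_angular Vd) /measurable_int /measurable_EFinP.
rewrite /quadratic_energy Rintegral_grad_sq_cscale// mulrBr mulrDr.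
congr (_ + _ - _); first by rewrite mulrCA.
  rewrite -RintegralZl_gt0 ?exprn_gt0//; apply: eq_Rintegral => x _.
  by rewrite cabsZ ?ltW// exprMn mulrCA.
rewrite mulrCA; congr (_ * _); rewrite -RintegralZl_gt0 ?exprn_gt0//.
apply: Rintegral_ae_eq; first exact: mang.
  by apply: measurable_funM => //; exact: mang.
apply: filterS2 (weak_partial_cscale i1 c0 H1phi) (weak_partial_cscale i2 c0 H1phi).
move=> x w1 w2; rewrite /Lz w1 w2 /cscale.
case: (phi x) (weak_partial i1 phi x) (weak_partial i2 phi x) => [a b] [u v] [s t] /=.
ring.
Qed.

Lemma mass_cscale c phi : 0 < c -> mass (cscale c phi) = c ^+ 2 * mass phi.
Proof. by move=> c0; rewrite /mass CLnorm_cscale// ?pnatr_eq0// exprMn. Qed.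

Lemma mass_ge0 phi : 0 <= mass phi.
Proof. exact: sqr_ge0. Qed.

Lemma mass_eq0 phi : L2 phi -> mass phi = 0 -> {ae mu, forall x, phi x = 0}.
Proof.
move=> L2phi; rewrite /mass CLnorm2_sqr => m0.
have ic := L2_integrable_cabs_sqr L2phi.
have : ae_eq mu setT (fun x => (cabs (phi x) ^+ 2)%:E) (cst 0%E).
  apply/ae_eq_integral_abs => //; first exact: (measurable_int _ ic).
  transitivity (\int[mu]_x (cabs (phi x) ^+ 2)%:E)%E.
    by apply: eq_integral => x _; rewrite gee0_abs// lee_fin sqr_ge0.
  by rewrite -[LHS]fineK; [rewrite -[fine _]/(\int[mu]_x _) m0|exact: integrable_fin_num].
apply: filterS => x /(_ I)[] /eqP; rewrite sqrf_eq0 => /eqP.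
exact: ComplexField.Normc.eq0_normc.
Qed.

(** A function of mass zero vanishes almost everywhere, which kills the angular
term; the other terms are nonnegative. *)
Lemma action_ge0_mass0 V p Omega omega phi : (forall x, 0 <= V x) -> 1 < p ->
  coord_sqr_dominated V -> energy_space V phi -> mass phi = 0 ->
  0 <= action V p Omega omega phi.
Proof.
move=> V0 p1 Vd X m0; rewrite /action m0 mulr0 addr0 energyE /quadratic_energy.
have phi0 := mass_eq0 X.1.1 m0.
rewrite (_ : \int[mu]_x Re _ = 0) ?mulr0 ?subr0; last first.
  rewrite (@Rintegral_ae_eq _ _ _ (cst 0)) ?Rintegral_cst ?mul0r//.
    by apply/measurable_EFinP; exact: (measurable_int _ (integrable_angular Vd X)).
  by apply: filterS phi0 => x ->; rewrite conjc0 mul0r.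
rewrite !addr_ge0 ?mulr_ge0 ?Rintegral_ge0 ?invr_ge0 ?powR_ge0//.
- by move=> x _; exact: grad_sq_ge0.
- by move=> x _; rewrite mulr_ge0// sqr_ge0.
- by rewrite addr_ge0// ltW// (lt_trans ltr01).
Qed.

(** Small multiples of a function with Rayleigh quotient below -omega: the
quadratic part dominates the power p + 1 > 2 near 0. *)
Lemma exists_negative_action V p Omega omega : 1 < p -> coord_sqr_dominated V ->
  (omega%:E < - lambda0 V Omega)%E ->
  exists2 psi, energy_space V psi & action V p Omega omega psi < 0.
Proof.
move=> p1 Vd; rewrite lteNr => /ereal_inf_lt[_ [phi [X phin0] <-]].
rewrite -EFinN lte_fin rayleighE// => Q.
have M0 : 0 < mass phi.
  rewrite lt_neqAle mass_ge0 andbT eq_sym; apply/eqP => /(mass_eq0 X.1.1).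
  exact: phin0.
move: Q; rewrite ltr_pdivrMr// => Q.
set q := quadratic_energy V Omega phi in Q.
pose a := - (q + omega * mass phi).
have a0 : 0 < a by rewrite /a; lra.
set N := CLnorm (p + 1) phi.
have N0 : 0 <= N by rewrite fine_ge0// Lnorm_ge0.
pose B := 2 / (p + 1) * N `^ (p + 1).
have B0 : 0 <= B.
  by rewrite mulr_ge0 ?powR_ge0// divr_ge0//; lra.
(* The action of c phi is c^2 (c^(p-1) B - a), so c is chosen with
   c^(p-1) = s and s B < a; the summand 1 covers the case B = 0. *)
pose s := a / (2 * (B + 1)).
have s0 : 0 < s by rewrite divr_gt0//; lra.
pose c := s `^ (p - 1)^-1.
have c0 : 0 < c by rewrite powR_gt0.
have cs : c `^ (p - 1) = s.
  by rewrite -powRrM mulVf ?powRr1 ?ltW//; lra.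
exists (cscale c phi); first exact: energy_space_cscale.
rewrite /action energyE quadratic_energy_cscale// mass_cscale//.
rewrite CLnorm_cscale//; last by lra.
rewrite -/q -/N (powRM _ (ltW c0) N0).
have -> : c `^ (p + 1) = c ^+ 2 * s.
  rewrite -cs -powR_mulrn ?ltW// -powRD; last by rewrite (gt_eqF c0) implybT.
  by congr (_ `^ _); ring.
have -> : c ^+ 2 * q + 2 / (p + 1) * (c ^+ 2 * s * N `^ (p + 1)) +
    omega * (c ^+ 2 * mass phi) = c ^+ 2 * (B * s - a).
  by rewrite /B /a; ring.
rewrite pmulr_rlt0 ?exprn_gt0// subr_lt0 /s mulrA ltr_pdivrMr; last by lra.
nra.
Qed.

Lemma action_le_energy V p Omega omega phi psi : mass psi = mass phi ->
  (action V p Omega omega phi <= action V p Omega omega psi) =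
  (energy V p Omega phi <= energy V p Omega psi).
Proof. by rewrite /action => ->; rewrite lerD2r. Qed.

End ground_state_theory.

Theorem theorem4p1 (R : realType) (n : nat) (p : R)
    (V : 'rV[R]_n.+2 -> R) (Omega omega : R)
    (p_gt1 : 1 < p)
    (p_subcritical : (3 <= n.+2)%N -> p < (n.+2%:R + 2) / (n.+2%:R - 2))
    (V_ge0 : forall x, 0 <= V x)
    (V_cvg : V x @[x --> at_infinity] --> +oo)
    (Omega_max_gt0 : (0 < Omega_max V)%E)
    (Omega_gt0 : 0 < Omega)
    (Omega_lt : (Omega%:E < Omega_max V)%E)
    (omega_lt : (omega%:E < - lambda0 V Omega)%E) :
  (forall phi, action_ground_states V p Omega omega phi ->
     energy_ground_states V p Omega (mass phi) phi /\
     energy_ground_states V p Omega (mass phi) `<=`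
       action_ground_states V p Omega omega) /\
  action_ground_states V p Omega omega =
    \bigcup_(m in [set mass phi | phi in action_ground_states V p Omega omega])
      energy_ground_states V p Omega m.
Proof.
have Vd := Omega_max_coord_sqr_dominated V_ge0 Omega_max_gt0.
have mass_gt0 phi : action_ground_states V p Omega omega phi -> 0 < mass phi.
  move=> [X phi_min]; rewrite lt_neqAle mass_ge0 andbT eq_sym.
  apply/eqP => m0; have [psi Xpsi neg] := exists_negative_action p_gt1 Vd omega_lt.
  have := le_lt_trans (phi_min _ Xpsi) neg.
  by rewrite ltNge action_ge0_mass0.
have AB phi : action_ground_states V p Omega omega phi ->
    energy_ground_states V p Omega (mass phi) phi.
  move=> A; have [X phi_min] := A; split; [exact: mass_gt0|exact: X|exact: erefl|].
  move=> psi Xpsi mpsi; rewrite -(action_le_energy _ _ _ omega mpsi).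
  exact: phi_min.
have BA phi : action_ground_states V p Omega omega phi ->
    energy_ground_states V p Omega (mass phi) `<=` action_ground_states V p Omega omega.
  move=> [X phi_min] psi [_ Xpsi mpsi psi_min]; split; first exact: Xpsi.
  move=> xi Xxi; apply: le_trans (phi_min _ Xxi).
  rewrite (action_le_energy _ _ _ _ (esym mpsi)); apply: psi_min; first exact: X.
  exact: erefl.
split; first by move=> phi A; split; [exact: AB|exact: BA].
apply/seteqP; split=> [phi A|psi [_ [phi A <-]]]; last exact: BA.
by exists (mass phi); [exists phi|exact: AB].
Qed.
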